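(* Let $G=(V,E)$ be a finite, connected, balanced bipartite graph with $V=[m]$. Then there is a closed interval $\mathcal J=\mathcal J(G)\subset\mathbb R^m$, depending only on $G$, such that, for the graph-based Pólya's urn on $G$ with any initial numbers of balls $B_1(0),\ldots,B_m(0)\ge 1$, the vector of proportions $x(n)=(x_1(n),\ldots,x_m(n))$ converges, as $n\to\infty$, to a (possibly random) point of $\mathcal J$ almost surely.
   Context: Let $G=(V,E)$ be a finite connected (simple, undirected) graph with $V=[m]=\{1,\ldots,m\}$ and $|E|=N$. Bipartite graphs. $G$ is bipartite if there is a partition $V=A\cup B$ (with $A$, $B$ disjoint) such that for every $\{i,j\}\in E$ either $i\in A, j\in B$ or $i\in B, j\in A$. If $\#A=\#B$, $G$ is called balanced bipartite; if $\#A\neq\#B$, $G$ is called unbalanced bipartite. Graph-based Pólya's urn (linear case). Place a bin at each vertex $i\in[m]$, containing initially an integer number $B_i(0)\ge 1$ of balls. Let $B_i(n)$ be the number of balls in bin $i$ after step $n$. At step $n\ge 1$, for each edge $\{i,j\}\in E$ one ball is added either to bin $i$ or to bin $j$ (so that $N$ balls in total are added at each step), and, conditionally on the process up to step $n-1$, the probability that the ball of the edge $\{i,j\}$ is added to $i$ is $$\frac{B_i(n-1)}{B_i(n-1)+B_j(n-1)}.$$ Proportions. Let $N_0=\sum_{i=1}^m B_i(0)$, let $x_i(n)=\frac{B_i(n)}{N_0+nN}$ for $i\in[m]$, and let $x(n)=(x_1(n),\ldots,x_m(n))\in\mathbb R^m$. Closed interval. A closed interval in $\mathbb R^m$ means a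 closed line segment $\{(1-t)p+tq: t\in[0,1]\}$ with $p,q\in\mathbb R^m$; the case $p=q$ (a single point) is allowed. The limit point in $\mathcal J$ may depend on the realization of the process. *)

(* Defs.v *)
From HB Require Import structures.
From mathcomp Require Import all_boot all_order all_algebra.
From mathcomp Require Import all_classical all_reals all_analysis.

Set Implicit Arguments.
Unset Strict Implicit.
Unset Printing Implicit Defensive.

Import Order.TTheory GRing.Theory Num.Theory.

Local Open Scope classical_set_scope.
Local Open Scope ring_scope.

(* A simple undirected graph on the vertex set 'I_m is given by its set E of
   edges; an edge is a two-element set of vertices. *)
Definition simple_graph m (E : {set {set 'I_m}}) : Prop :=
  forall f : {set 'I_m}, f \in E -> #|f| = 2%N.

Definition adjacent m (E : {set {set 'I_m}}) : rel 'I_m :=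
  fun i j => [set i; j]%SET \in E.

Definition connected_graph m (E : {set {set 'I_m}}) : Prop :=
  forall i j : 'I_m, connect (adjacent E) i j.

Definition bipartition m (E : {set {set 'I_m}}) (A B : {set 'I_m}) : Prop :=
  [/\ (A :|: B)%SET = [set: 'I_m]%SET,
      (A :&: B)%SET = finset.set0 &
      forall i j : 'I_m, [set i; j]%SET \in E ->
        (i \in A /\ j \in B) \/ (i \in B /\ j \in A)].

Definition balanced_bipartite m (E : {set {set 'I_m}}) : Prop :=
  exists A B : {set 'I_m}, bipartition E A B /\ #|A| = #|B|.

(* c n f w is the bin receiving the ball of the edge f at step n (n >= 1);
   only its values for f in E and n >= 1 matter. *)
Fixpoint balls m (E : {set {set 'I_m}}) (B0 : 'I_m -> nat) (Omega : Type)
    (c : nat -> {set 'I_m} -> Omega -> 'I_m) (n : nat) (w : Omega) (i : 'I_m)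
    : nat :=
  if n is n'.+1 then
    (balls E B0 c n' w i + #|[set f in E | c n f w == i]%SET|)%N
  else B0 i.

Definition history m (E : {set {set 'I_m}}) (B0 : 'I_m -> nat) (Omega : Type)
    (c : nat -> {set 'I_m} -> Omega -> 'I_m) (n : nat) (h : nat -> 'I_m -> nat)
    : set Omega :=
  [set w | forall k i, (k <= n)%N -> balls E B0 c k w i = h k i].

(* Elementary conditional probability, meaningful when P H > 0. *)
Definition cond_prob (R : realType) (d : measure_display)
    (Omega : measurableType d) (P : probability Omega R) (A H : set Omega) : R :=
  fine (P (A `&` H)) / fine (P H).

(* The process takes countably many values up to any given time, so its law
   given the past is specified on each past of positive probability.  Nothing
   is assumed on the joint law of the choices made by the different edges
   within a step. *)
Definition polya_urn (R : realType) m (E : {set {set 'I_m}}) (B0 : 'I_m -> nat)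
    (d : measure_display) (Omega : measurableType d) (P : probability Omega R)
    (c : nat -> {set 'I_m} -> Omega -> 'I_m) : Prop :=
  [/\ forall n f i, f \in E -> measurable [set w | c n.+1 f w = i],
      forall n f w, f \in E -> c n.+1 f w \in f &
      forall n (i j : 'I_m) (h : nat -> 'I_m -> nat),
        [set i; j]%SET \in E ->
        (0 < P (history E B0 c n h))%E ->
        cond_prob P [set w | c n.+1 [set i; j]%SET w = i] (history E B0 c n h)
        = (h n i)%:R / (h n i + h n j)%N%:R].

Definition proportions (R : realType) m (E : {set {set 'I_m}})
    (B0 : 'I_m -> nat) (Omega : Type)
    (c : nat -> {set 'I_m} -> Omega -> 'I_m) (n : nat) (w : Omega) : 'rV[R]_m :=
  \row_(i < m) ((balls E B0 c n w i)%:R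
                / (\sum_(j < m) B0 j + n * #|E|)%N%:R).

Definition closed_interval (R : realType) m (J : set 'rV[R]_m) : Prop :=
  exists p q : 'rV[R]_m,
    J = [set (1 - t) *: p + t *: q | t in [set t : R | 0 <= t <= 1]].

(* Main.v *)
Require Import Defs.
From HB Require Import structures.
From mathcomp Require Import all_boot all_order all_algebra.
From mathcomp Require Import all_classical all_reals all_analysis.
From mathcomp Require Import measurable_realfun ring lra.

Set Implicit Arguments.
Unset Strict Implicit.
Unset Printing Implicit Defensive.

Import Order.TTheory GRing.Theory Num.Theory.
Import numFieldNormedType.Exports.

Local Open Scope classical_set_scope.
Local Open Scope ring_scope.

(** Let [b_i(n)] be the contents, [S(n)] their total, [x(n) = b(n) / S(n)], and
    let the load of an edge be the sum of a vector over its two ends. Given the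
    past, an edge [f] feeds its end [i] with probability [b_i / load b f], so
    the expected relative growth of [b_i] during a step is the sum over the
    edges [f] at [i] of [1 / load b f]: the own content of the bin cancels.

    The centred relative growths are martingale increments. The squares of the
    relative growths have a sum bounded along every realization
    ([relative_increment_sqr_sum]), so the martingale is bounded in mean square
    and converges almost surely ([martingale_cvg]); for the same reason [ln b_i]
    differs from the sum of its relative growths by a convergent sequence. Hence
    almost surely, for every [i], [ln b_i(n)] minus the accumulated rates
    converges ([ln_balls_sub_rates_cvg]). Nothing else is random: the rest holds
    on every such realization ([trajectory_cvg]).

    Weighting these statements by a vector [u] and summing over the bins turns
    the rates into the sum over edges of [load u f / load b f]. Two choices of
    [u] matter. For a point [v] of the simplex maximizing the product of the
    loads, one gets that [sum_i v_i ln x_i(n)] is a convergent sequence plus the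
    sum over [k < n] of [gap(x(k)) / S(k)], where [gap >= 0] vanishes only at
    points with the loads of [v] ([gap_ge0], [gap_le0_load]). As the left side
    is nonpositive, the accumulated gap is finite and [sum_i v_i ln x_i]
    converges. For [s], equal to 1 on one side and to -1 on the other, all
    loads vanish, and so does the total because the sides have equal size; so
    [sum_i s_i ln x_i] converges.

    Since the sum of [1 / S(k)] diverges, the gap is small infinitely often, and
    some cluster point [w] of [x] has the loads of [v]. Connectedness makes [w]
    of the form [v + t s] ([load_eq0_side]); these points form the interval. Now
    [sum_i w_i ln x_i] is a combination of the two convergent sums above, so the
    relative entropy of [w] with respect to [x(n)] converges; it tends to 0 along
    a subsequence, hence altogether, and it controls the distance from [x(n)] to
    [w] ([sqr_dist_le_entropy]). *)

(** * Convergent real sequences *)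

Lemma cvg_sumr {R : realType} {T I : Type} (F : set_system T) {FF : Filter F}
    (r : seq I) (p : pred I) (f : I -> T -> R) (a : I -> R) :
  (forall i, p i -> f i x @[x --> F] --> a i) ->
  \sum_(i <- r | p i) f i x @[x --> F] --> \sum_(i <- r | p i) a i.
Proof. by move=> fa; apply: cvg_big => //; exact: add_continuous. Qed.

Lemma is_cvg_sumr {R : realType} {I : Type} (r : seq I) (p : pred I)
    (f : I -> nat -> R) :
  (forall i, p i -> cvgn (f i)) ->
  cvgn (fun n => \sum_(i <- r | p i) f i n).
Proof.
move=> fc; apply/cvg_ex; exists (\sum_(i <- r | p i) limn (f i)).
by apply: cvg_sumr => i; exact: fc.
Qed.

Lemma eq_cvgn {R : realType} (u v : nat -> R) : u =1 v -> cvgn u -> cvgn v.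
Proof. by move=> /funext ->. Qed.

Lemma ln_le_sub1 {R : realType} (r : R) : 0 < r -> ln r <= r - 1.
Proof.
move=> r0; rewrite -[in leLHS](subrK 1 r) addrC; apply: le_ln1Dx.
by rewrite ltrBrDr addNr.
Qed.

Lemma ln_ge1Vx {R : realType} (x : R) : 0 < x -> 1 - x^-1 <= ln x.
Proof.
move=> x0; have : 0 < x^-1 by rewrite invr_gt0.
by move=> /ln_le_sub1; rewrite lnV ?posrE//; lra.
Qed.

Section SlowGrowth.
Context {R : realType}.
Variables (a : R) (b : nat -> R).
Hypothesis a0 : 0 <= a.
Hypothesis b0 : 1 <= b 0.
Hypothesis bS : forall k, b k <= b k.+1 <= b k + a.

Lemma slow_growth_ge1 n : 1 <= b n.
Proof. by elim: n => // n IH; have /andP[h _] := bS n; exact: le_trans h. Qed.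

Let b_gt0 n : 0 < b n.
Proof. exact: lt_le_trans (slow_growth_ge1 n). Qed.

(** Consecutive values are comparable, so [((b' - b) / b) ^+ 2] is at most a
    constant times [b^-1 - b'^-1], which telescopes. *)
Lemma relative_increment_sqr_sum n :
  \sum_(k < n) ((b k.+1 - b k) / b k) ^+ 2 <= a * (a + 1).
Proof.
suff : \sum_(k < n) ((b k.+1 - b k) / b k) ^+ 2
         <= a * (a + 1) * ((b 0)^-1 - (b n)^-1).
  move/le_trans; apply; rewrite ler_piMr ?mulr_ge0 ?addr_ge0//.
  rewrite lerBlDr (@le_trans _ _ 1) ?invf_le1// lerDl invr_ge0 ltW//.
elim: n => [|n IH]; first by rewrite big_ord0 subrr mulr0.
rewrite big_ord_recr/=.
have -> : (b 0)^-1 - (b n.+1)^-1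
   = ((b 0)^-1 - (b n)^-1) + ((b n)^-1 - (b n.+1)^-1) by ring.
rewrite mulrDr lerD//.
have /andP[h1 h2] := bS n.
have x1 := slow_growth_ge1 n; have x0 := b_gt0 n; have y0 := b_gt0 n.+1.
move: (b n) (b n.+1) h1 h2 x1 x0 y0 => x y h1 h2 x1 x0 y0.
have -> : a * (a + 1) * (x^-1 - y^-1) = (y - x) * (a * ((a + 1) * x)) / (x ^+ 2 * y).
  by field; rewrite ?gt_eqF.
have -> : ((y - x) / x) ^+ 2 = (y - x) * ((y - x) * y) / (x ^+ 2 * y).
  by field; rewrite ?gt_eqF.
rewrite ler_pM2r ?invr_gt0 ?mulr_gt0 ?exprn_gt0//.
rewrite ler_wpM2l ?subr_ge0//.
have ax : 0 <= a * (x - 1) by rewrite mulr_ge0// subr_ge0.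
by apply: ler_pM; rewrite ?subr_ge0 ?(ltW y0)//; lra.
Qed.

(** Each step errs by [r - ln (1 + r)] with [r] the relative increment; this
    lies between 0 and [r ^+ 2], so the errors are summable. *)
Lemma ln_sub_relative_increments_cvg :
  cvgn (fun n => ln (b n) - \sum_(k < n) (b k.+1 - b k) / b k).
Proof.
pose u n := \sum_(k < n) (b k.+1 - b k) / b k - ln (b n).
have -> : (fun n => ln (b n) - \sum_(k < n) (b k.+1 - b k) / b k) = - u.
  by apply/funext => n; rewrite /u /= fctE opprB.
apply: is_cvgN.
have du n : 0 <= u n.+1 - u n <= ((b n.+1 - b n) / b n) ^+ 2.
  have -> : u n.+1 - u n = (b n.+1 - b n) / b n - ln (b n.+1 / b n).
    rewrite /u big_ord_recr/= ln_div ?posrE//; lra.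
  have /andP[h1 h2] := bS n.
  have x0 := b_gt0 n; have y0 := b_gt0 n.+1.
  move: (b n) (b n.+1) h1 h2 x0 y0 => x y h1 h2 x0 y0.
  have l1 := @ln_ge1Vx R (y / x) (divr_gt0 y0 x0).
  have l2 : ln (y / x) <= (y - x) / x.
    have -> : y / x = 1 + (y - x) / x by field; rewrite gt_eqF.
    by apply: le_ln1Dx; rewrite (@lt_le_trans _ _ 0)// divr_ge0 ?subr_ge0// ltW.
  rewrite subr_ge0 l2/=.
  apply: (@le_trans _ _ ((y - x) / x - (1 - (y / x)^-1))); first by rewrite lerD2l lerN2.
  have -> : (y - x) / x - (1 - (y / x)^-1) = ((y - x) / x) * ((y - x) / y).
    by field; rewrite ?gt_eqF.
  rewrite expr2; apply: ler_wpM2l; first by rewrite divr_ge0 ?subr_ge0// ltW.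
  by apply: ler_wpM2l; rewrite ?subr_ge0// lef_pV2 ?posrE.
apply: nondecreasing_is_cvgn.
  by apply/nondecreasing_seqP => n; rewrite -subr_ge0; have /andP[] := du n.
exists (u 0%N + a * (a + 1)) => _ [n _ <-].
apply: (@le_trans _ _ (u 0%N + \sum_(k < n) ((b k.+1 - b k) / b k) ^+ 2)); last first.
  by rewrite lerD2l relative_increment_sqr_sum.
elim: n => [|n IH]; first by rewrite big_ord0 addr0.
rewrite big_ord_recr/= addrA; have /andP[_] := du n.
move: IH; set s := u 0%N + _; lra.
Qed.

End SlowGrowth.

(** * Martingales over finitely valued pasts *)

(** Adaptedness without sigma-algebras: [H] records the past of a process up to
    some time. *)
Definition factors_through (Omega T U : Type) (H : Omega -> T)
    (f : Omega -> U) : Prop :=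
  forall w w', H w = H w' -> f w = f w'.

Lemma factors_throughP (Omega T U : Type) (u0 : U) (H : Omega -> T)
    (f : Omega -> U) :
  factors_through H f -> exists g : T -> U, forall w, g (H w) = f w.
Proof.
move=> fH.
exists (fun t => if pselect (exists w, H w = t) is left e
                 then f (projT1 (cid e)) else u0) => w.
case: pselect => [e|[]]; last by exists w.
by case: cid => w' /= /fH.
Qed.

Section FiniteExpectation.
Context {R : realType} {d : measure_display} {Omega : measurableType d}.
Variable P : probability Omega R.

Definition mean (f : Omega -> R) : R := \int[P]_w f w.

Lemma mean_sum (I : Type) (r : seq I) (p : pred I) (f : I -> Omega -> R) :
  (forall i, p i -> P.-integrable setT (EFin \o f i)) ->
  mean (fun w => \sum_(i <- r | p i) f i w) = \sum_(i <- r | p i) mean (f i).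
Proof.
move=> fint; elim: r => [|i r IH].
  under [in LHS]eq_fun do rewrite big_nil.
  by rewrite /mean Rintegral_cst// mul0r big_nil.
under [in LHS]eq_fun do rewrite big_cons.
rewrite big_cons; case: ifP => // pi.
have rint : P.-integrable setT (EFin \o (fun w => \sum_(j <- r | p j) f j w)).
  have -> : EFin \o (fun w => \sum_(j <- r | p j) f j w) =
      (fun w => \sum_(j <- r | p j) (EFin \o f j) w)%E.
    by apply/funext => w /=; rewrite sumEFin.
  exact: integrable_sum.
by rewrite -IH /mean -RintegralD//; exact: fint.
Qed.

Section Level.
Variables (T : finType) (H : Omega -> T).
Hypothesis mH : forall t, measurable [set w | H w = t].

Lemma measurable_level (A : set Omega) :
  (forall w w', H w = H w' -> A w -> A w') -> measurable A.
Proof.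
move=> AH.
have -> : A = \bigcup_(t in [set t | exists2 w, H w = t & A w])
                [set w | H w = t].
  apply/seteqP; split => w /=.
    by move=> Aw; exists (H w) => //=; exists w.
  by move=> [t [w' <- Aw'] /= e]; apply: (AH w') => //; rewrite e.
by apply: fin_bigcup_measurable => // i _; exact: mH.
Qed.

(** Only finitely many values are taken, on measurable fibres. *)
Lemma integrable_level (f : Omega -> R) :
  factors_through H f -> P.-integrable setT (EFin \o f).
Proof.
move=> fH; apply: measurable_bounded_integrable => //.
- by rewrite (le_lt_trans (probability_le1 P measurableT))// ltry.
- move=> _ Y _; rewrite setTI; apply: measurable_level => w w' e /=.
  by rewrite (fH w w').
- have [w0|noO] := pselect (inhabited Omega); last first.
    by exists 0; split=> // x _ w _; case: noO; exists.
  have [w1] := w0.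
  have [g gH] := factors_throughP 0 fH.
  exists (\sum_t `|g t|); split; first by rewrite num_real.
  move=> x lx w _ /=; rewrite (le_trans _ (ltW lx))// -gH.
  by rewrite (bigD1 (H w))//= lerDl sumr_ge0.
Qed.

Lemma meanD f g : factors_through H f -> factors_through H g ->
  mean (fun w => f w + g w) = mean f + mean g.
Proof. by move=> fH gH; rewrite /mean RintegralD//; exact: integrable_level. Qed.

Lemma meanZ a f : factors_through H f ->
  mean (fun w => a * f w) = a * mean f.
Proof. by move=> fH; rewrite /mean RintegralZl//; exact: integrable_level. Qed.

Lemma le_mean f g : factors_through H f -> factors_through H g ->
  (forall w, f w <= g w) -> mean f <= mean g.
Proof. by move=> fH gH fg; apply: le_Rintegral => //; exact: integrable_level. Qed.

Lemma mean_indicator (A : set Omega) : measurable A ->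
  mean (\1_A) = fine (P A).
Proof. by move=> mA; rewrite /mean /Rintegral integral_indic// setIT. Qed.

End Level.

Lemma mean_cst a : mean (cst a) = a.
Proof.
rewrite /mean Rintegral_cst// -[RHS]mulr1; congr (_ * _).
exact: (congr1 fine (probability_setT P)).
Qed.

(** A function of the present is a finite combination of indicators of
    histories, so being centred on every history is the same as being
    orthogonal to the past. *)
Lemma mean_mul0 (T T' : finType) (H : Omega -> T) (H' : Omega -> T')
    (D f : Omega -> R) :
  (forall t, measurable [set w | H' w = t]) ->
  factors_through H' H -> factors_through H' D ->
  (forall t, mean (fun w => (H w == t)%:R * D w) = 0) ->
  factors_through H f -> mean (fun w => f w * D w) = 0.
Proof.
move=> mH' HH' DH' D0 fH.
have [g gH] := factors_throughP 0 fH.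
have -> : (fun w => f w * D w) = (fun w => \sum_t g t * ((H w == t)%:R * D w)).
  apply/funext => w; rewrite (bigD1 (H w))//= eqxx mul1r gH big1 ?addr0// => t.
  by rewrite eq_sym => /negbTE ->; rewrite mul0r mulr0.
have fact t : factors_through H' (fun w => (H w == t)%:R * D w).
  by move=> w w' e; rewrite (HH' _ _ e) (DH' _ _ e).
rewrite mean_sum; last first.
  by move=> t _; apply: (integrable_level mH') => w w' /fact ->.
by rewrite big1// => t _; rewrite (meanZ mH')// D0 mulr0.
Qed.

End FiniteExpectation.

Section Martingale.
Context {R : realType} {d : measure_display} {Omega : measurableType d}.
Variable P : probability Omega R.

(** [D n] is the [n]-th increment of a martingale for the filtration generated
    by the finitely valued pasts [H n]; the conditional expectation is tested
    on the fibres of [H n], which generate it. *)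
Record centred_increments (T : nat -> finType) (H : forall n, Omega -> T n)
    (D : nat -> Omega -> R) : Prop := CentredIncrements {
  ci_meas : forall n t, measurable [set w | H n w = t];
  ci_refine : forall n, factors_through (H n.+1) (H n);
  ci_adapted : forall n, factors_through (H n.+1) (D n);
  ci_centred : forall n t, mean P (fun w => (H n w == t)%:R * D n w) = 0 }.

(** The event that the exit time from the interval of radius [e] exceeds [n]; the
    recursion makes it plain that it depends on the past at time [n] only. *)
Fixpoint confined (D : nat -> Omega -> R) (e : R) (n : nat) (w : Omega) : bool :=
  if n is n'.+1 then
    confined D e n' w && (`|\sum_(k < n) D k w| < e)
  else true.

Section Maximal.
Variables (T : nat -> finType) (H : forall n, Omega -> T n).
Variable D : nat -> Omega -> R.
Hypothesis cD : centred_increments H D.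

Lemma refine_le m n : (m <= n)%N -> factors_through (H n) (H m).
Proof.
elim: n => [|n IH]; first by rewrite leqn0 => /eqP ->.
rewrite leq_eqVlt => /predU1P[->//|/IH mn] w w' /(ci_refine cD).
exact: mn.
Qed.

Lemma increment_level k n : (k < n)%N -> factors_through (H n) (D k).
Proof. by move=> kn w w' /(refine_le kn)/(ci_adapted cD). Qed.

Lemma sum_level n : factors_through (H n) (fun w => \sum_(k < n) D k w).
Proof. by move=> w w' e; apply: eq_bigr => k _; apply: increment_level e. Qed.

Variable e : R.

Lemma confined_level n : factors_through (H n) (confined D e n).
Proof.
elim: n => //= n IH w w' E /=.
have /= -> := sum_level E.
by rewrite (IH w w')//; exact: (ci_refine cD).
Qed.

(** The martingale frozen at its first exit from the interval: the exit time is
    encoded by switching off the later increments. *)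
Definition stopped n w := \sum_(k < n) (confined D e k w)%:R * D k w.

Lemma stoppedS n w :
  stopped n.+1 w = stopped n w + (confined D e n w)%:R * D n w.
Proof. by rewrite /stopped big_ord_recr. Qed.

Lemma stopped_level n : factors_through (H n) (stopped n).
Proof.
move=> w w' E; apply: eq_bigr => k _.
rewrite (increment_level _ E)//.
by rewrite (confined_level (refine_le (ltnW (ltn_ord k)) E)).
Qed.

Lemma stopped_confined n w : confined D e n w ->
  stopped n w = \sum_(k < n) D k w.
Proof.
elim: n => [|n IH]; first by rewrite /stopped !big_ord0.
by rewrite /= => /andP[cn _]; rewrite stoppedS IH// cn mul1r big_ord_recr.
Qed.

Lemma stopped_exit n w : ~~ confined D e n w -> e <= `|stopped n w|.
Proof.
elim: n => [//|n IH] /=.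
rewrite stoppedS.
have [cn /=|/IH cn _] := boolP (confined D e n w); last first.
  by rewrite mul0r addr0.
by rewrite -leNgt mul1r stopped_confined// big_ord_recr.
Qed.

(** Whether the next increment is switched on depends on the past only, so the
    cross terms of the square vanish in the mean. *)
Lemma mean_stopped_sqr n :
  mean P (fun w => stopped n w ^+ 2) <= \sum_(k < n) mean P (fun w => D k w ^+ 2).
Proof.
elim: n => [|n IH].
  rewrite big_ord0; have -> : (fun w => stopped 0 w ^+ 2) = cst 0.
    by apply/funext => w; rewrite /stopped big_ord0 expr0n.
  by rewrite mean_cst.
rewrite big_ord_recr/=.
have mH := @ci_meas _ _ _ cD n.+1.
have Hn := @ci_refine _ _ _ cD n.
pose c w : R := 2 * stopped n w * (confined D e n w)%:R.
have cH : factors_through (H n) c.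
  by move=> w w' E; rewrite /c (stopped_level E) (confined_level E).
have sH : factors_through (H n.+1) (fun w => stopped n w ^+ 2).
  by move=> w w' /Hn/stopped_level ->.
have dH : factors_through (H n.+1) (fun w => D n w ^+ 2).
  by move=> w w' /(ci_adapted cD) ->.
have cdH : factors_through (H n.+1) (fun w => c w * D n w).
  by move=> w w' E; rewrite (cH _ _ (Hn _ _ E)) (ci_adapted cD E).
apply: (@le_trans _ _ (mean P (fun w => stopped n w ^+ 2 + (c w * D n w + D n w ^+ 2)))).
  apply: (le_mean P mH).
  - by move=> w w' /stopped_level ->.
  - by move=> w w' E; rewrite (sH _ _ E) (cdH _ _ E) (dH _ _ E).
  - move=> w; rewrite stoppedS /c.
    case: (confined _ _ _ _); last first.
      by rewrite mul0r addr0 mulr0 mul0r add0r lerDl sqr_ge0.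
    by rewrite mul1r mulr1 le_eqVlt; apply/orP; left; apply/eqP; ring.
rewrite (meanD _ mH)//; last by move=> w w' E; rewrite (cdH _ _ E) (dH _ _ E).
rewrite (meanD _ mH)//.
rewrite (mean_mul0 mH Hn (@ci_adapted _ _ _ cD n) (@ci_centred _ _ _ cD n) cH).
by rewrite add0r lerD2r.
Qed.

(** Kolmogorov's maximal inequality: Chebyshev's inequality for the martingale
    stopped when it leaves the interval. *)
Lemma maximal_inequality n : 0 <= e ->
  e ^+ 2 * fine (P [set w | ~~ confined D e n w]) <=
  \sum_(k < n) mean P (fun w => D k w ^+ 2).
Proof.
move=> e0; apply: le_trans (mean_stopped_sqr n).
have mA : measurable [set w | ~~ confined D e n w].
  by apply: (measurable_level (@ci_meas _ _ _ cD n)) => w w' /confined_level /= ->.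
rewrite -mean_indicator//.
have iE w : \1_[set w | ~~ confined D e n w] w = (~~ confined D e n w)%:R :> R.
  by rewrite indicE; congr ((nat_of_bool _)%:R); apply/idP/idP; rewrite inE.
have iH : factors_through (H n) (\1_[set w | ~~ confined D e n w] : Omega -> R).
  by move=> w w' E; rewrite !iE (confined_level E).
rewrite -(meanZ P (@ci_meas _ _ _ cD n))//; apply: (le_mean P (@ci_meas _ _ _ cD n)).
- by move=> w w' /iH ->.
- by move=> w w' /stopped_level ->.
- move=> w; rewrite iE.
  have [c|/stopped_exit h] := boolP (confined D e n w).
    by rewrite mulr0 sqr_ge0.
  by rewrite mulr1 -[leRHS]real_normK ?num_real// lerXn2r ?nnegrE.
Qed.

End Maximal.
End Martingale.

Section MartingaleConvergence.
Context {R : realType} {d : measure_display} {Omega : measurableType d}.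
Variable P : probability Omega R.
Variables (T : nat -> finType) (H : forall n, Omega -> T n).
Variable D : nat -> Omega -> R.
Hypothesis cD : centred_increments P H D.

Lemma centred_increments_shift N :
  centred_increments P (fun n => H (n + N)%N) (fun n => D (n + N)%N).
Proof.
split => n.
- exact: (ci_meas cD).
- exact: (@ci_refine _ _ _ _ _ _ _ cD (n + N)%N).
- exact: (@ci_adapted _ _ _ _ _ _ _ cD (n + N)%N).
- exact: (@ci_centred _ _ _ _ _ _ _ cD (n + N)%N).
Qed.

Let V n := \sum_(k < n) mean P (fun w => D k w ^+ 2).
Let escape (N : nat) (e : R) n := [set w | ~~ confined (fun n => D (n + N)%N) e n w].

Let escape_measurable N e n : measurable (escape N e n).
Proof.
have cN := centred_increments_shift N.
apply: (measurable_level (@ci_meas _ _ _ _ _ _ _ cN n)) => w w' E.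
by rewrite /escape /= (confined_level cN _ E).
Qed.

Let escape_bound (N : nat) (e : R) n : 0 < e ->
  fine (P (escape N e n)) <= (V (n + N) - V N) / e ^+ 2.
Proof.
move=> e0; rewrite ler_pdivlMr ?exprn_gt0// mulrC.
apply: le_trans (maximal_inequality (centred_increments_shift N) n (ltW e0)) _.
have -> : V (n + N) - V N = \sum_(k < n) mean P (fun w => D (N + k)%N w ^+ 2).
  by rewrite addnC /V big_split_ord /= addrAC subrr add0r.
by rewrite le_eqVlt; apply/orP; left; apply/eqP/eq_bigr => k _; rewrite addnC.
Qed.

Let escape_nondecreasing N e : nondecreasing_seq (escape N e).
Proof.
apply/nondecreasing_seqP => n; apply/subsetPset => w /=.
by apply: contra => /andP[].
Qed.

Let escape_ever (N : nat) (e c : R) : 0 < e ->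
  (forall n, V (n + N) - V N <= c * e ^+ 2) ->
  (P (\bigcup_n escape N e n) <= c%:E)%E.
Proof.
move=> e0 Vc.
have mU : measurable (\bigcup_n escape N e n) by exact: bigcupT_measurable.
have cv := nondecreasing_cvg_mu (mu := P) (escape_measurable N e) mU
  (@escape_nondecreasing N e).
rewrite -(cvg_lim _ cv)//; apply: lime_le; first by apply/cvg_ex; eexists; exact: cv.
near=> n => /=.
have fE : P (escape N e n) \is a fin_num by rewrite fin_num_measure.
rewrite -[leLHS]fineK// lee_fin (le_trans (escape_bound N n e0))//.
by rewrite ler_pdivrMr ?exprn_gt0.
Unshelve. all: by end_near.
Qed.

(** Failure of the Cauchy criterion at scale [e] means that, from every starting
    time [N], some later partial sum is [e] away; by the maximal inequality
    this has probability at most [e ^- 2] times the tail after [N] of a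
    convergent series. *)
Lemma martingale_cvg (C : R) :
  (forall n, \sum_(k < n) mean P (fun w => D k w ^+ 2) <= C) ->
  {ae P, forall w, cvgn (fun n => \sum_(k < n) D k w)}.
Proof.
move=> VC.
have ndV : nondecreasing_seq V.
  apply/nondecreasing_seqP => n; rewrite /V big_ord_recr/= lerDl.
  by apply: Rintegral_ge0 => w _; exact: sqr_ge0.
have cV : cvgn V by apply: nondecreasing_is_cvgn => //; exists C => _ [n _ <-]; exact: VC.
have tail (c : R) : 0 < c -> exists N, forall n, V (n + N)%N - V N <= c.
  move=> c0.
  have /(_ _ c c0) := @cvgr_dist_le _ _ _ _ _ _ _ cV.
  move=> [N _ /(_ N (leqnn N)) /= h].
  exists N => n; rewrite (le_trans _ h)// (le_trans _ (ler_norm _))// lerD2r.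
  exact: nondecreasing_cvgn_le.
have small (e : R) : 0 < e -> P.-negligible (\bigcap_N \bigcup_n escape N e n).
  move=> e0.
  have mB : measurable (\bigcap_N \bigcup_n escape N e n).
    by apply: bigcapT_measurable => N; exact: bigcupT_measurable.
  apply/negligibleP => //; apply/eqP; rewrite -measure_le0.
  apply/lee_addgt0Pr => c c0; rewrite add0e.
  have [|N hN] := tail (c * e ^+ 2); first by rewrite mulr_gt0// exprn_gt0.
  apply: le_trans (escape_ever e0 hN).
  apply: le_measure; rewrite ?inE//; first exact: bigcupT_measurable.
  by move=> w; exact.
have : P.-negligible (\bigcup_r \bigcap_N \bigcup_n escape N r.+1%:R^-1 n).
  by apply: negligible_bigcup => r; apply: small; rewrite invr_gt0.
(* it is enough to test the Cauchy criterion at the scales [1 / (r + 1)] *)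
apply: negligibleS => w /= ncv; apply: contrapT => nB; apply: ncv.
apply/cauchy_cvgP; apply: cauchy_exP => e e0.
have [r re] : exists r : nat, r.+1%:R^-1 < e.
  exists (Num.truncn e^-1); rewrite invf_plt ?posrE ?ltr0n//.
  by rewrite truncnS_gt ?num_real.
have /existsNP[N] : ~ (\bigcap_N \bigcup_n escape N r.+1%:R^-1 n) w.
  by move=> h; apply: nB; exists r.
move=> /not_implyP[_ nE].
exists (\sum_(k < N) D k w).
exists N => // n /= Nn; rewrite /ball /= distrC.
have := nE; rewrite -(subnK Nn); move: (n - N)%N => k {}nE.
have : confined (fun n => D (n + N)%N) r.+1%:R^-1 k w.
  by apply: contrapT => /negP c; apply: nE; exists k.
rewrite [(k + N)%N]addnC big_split_ord/= addrAC subrr add0r.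
case: k nE => [|k] _; first by rewrite big_ord0 normr0.
move=> /andP[_ /lt_trans/(_ re)]; congr (`|_| < _).
by apply: eq_bigr => j _; rewrite addnC.
Qed.

End MartingaleConvergence.

(** * The urn *)

Section UrnCounting.
Context (m : nat) (E : {set {set 'I_m}}) (B0 : 'I_m -> nat) (Omega : Type).
Variable c : nat -> {set 'I_m} -> Omega -> 'I_m.
Hypothesis c_in : forall n f w, f \in E -> c n.+1 f w \in f.
Notation B := (balls E B0 c).

Lemma ballsS n w i :
  B n.+1 w i = (B n w i + \sum_(f in E | i \in f) (c n.+1 f w == i))%N.
Proof.
rewrite /=; congr (_ + _)%N; rewrite -sum1_card big_mkcondr/= big_mkcond/=.
rewrite [RHS]big_mkcond/=; apply: eq_bigr => f _; rewrite inE.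
have [fE|//] := boolP (f \in E); rewrite /=.
have [<-|] := eqVneq (c n.+1 f w) i; first by rewrite c_in.
by case: ifP.
Qed.

Lemma balls_mono n w i : (B n w i <= B n.+1 w i)%N.
Proof. exact: leq_addr. Qed.

Lemma balls_step n w i : (B n.+1 w i <= B n w i + #|E|)%N.
Proof.
rewrite /= leq_add2l subset_leq_card//; apply/fintype.subsetP => f.
by rewrite inE => /andP[].
Qed.

Lemma balls_total n w : (\sum_i B n w i = \sum_i B0 i + n * #|E|)%N.
Proof.
elim: n => [|n IH]; first by rewrite mul0n addn0.
rewrite /= big_split/= IH mulSn -addnA; congr addn; rewrite addnC; congr addn.
rewrite -sum1_card.
under eq_bigr do rewrite -sum1_card big_mkcond.
rewrite exchange_big [RHS]big_mkcond/=; apply: eq_bigr => f _.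
rewrite (bigD1 (c n.+1 f w))//= big1 ?addn0; first by rewrite inE eqxx andbT.
by move=> i; rewrite eq_sym inE => /negbTE ->; rewrite andbF.
Qed.

Lemma balls_edge n w f : f \in E -> (n <= \sum_(i in f) B n w i)%N.
Proof.
move=> fE; elim: n => // n IH; rewrite (eq_bigr _ (fun i _ => ballsS n w i)).
rewrite big_split/= -[leqLHS]addn1 leq_add//.
rewrite (bigD1 (c n.+1 f w)) ?c_in//= (bigD1 f)/=; last by rewrite fE c_in.
by rewrite eqxx.
Qed.

End UrnCounting.

Definition load (R : realType) m (x : 'I_m -> R) (f : {set 'I_m}) : R :=
  \sum_(i in f) x i.

Section UrnMartingale.
Context (R : realType) (m : nat) (E : {set {set 'I_m}}) (B0 : 'I_m -> nat).
Context (d : measure_display) (Omega : measurableType d).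
Variables (P : probability Omega R) (c : nat -> {set 'I_m} -> Omega -> 'I_m).
Hypothesis gE : simple_graph E.
Hypothesis B0_gt0 : forall i, (1 <= B0 i)%N.
Hypothesis urn : polya_urn E B0 P c.
Notation B := (balls E B0 c).

Let c_meas n f i : f \in E -> measurable [set w | c n.+1 f w = i].
Proof. by case: urn => h _ _; exact: h. Qed.

Let c_in n f w : f \in E -> c n.+1 f w \in f.
Proof. by case: urn => _ h _; exact: h. Qed.

(** Expected relative growth, during one step, of the content of [i] when the
    contents are [b]. *)
Definition rate (b : 'I_m -> R) (i : 'I_m) : R :=
  \sum_(f in E | i \in f) (load b f)^-1.

Definition relative_growth i n w : R :=
  ((B n.+1 w i)%:R - (B n w i)%:R) / (B n w i)%:R.

Definition fluctuation i n w : R :=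
  relative_growth i n w - rate (fun j => (B n w j)%:R) i.

(** The contents up to time [n] cannot exceed the total content at time [n], so
    they are recorded without loss in a finite type. *)
Definition past n (w : Omega) :
    {ffun 'I_n.+1 * 'I_m -> 'I_(\sum_i B0 i + n * #|E|).+1} :=
  [ffun p : 'I_n.+1 * 'I_m => inord (B p.1 w p.2)].

Lemma pastP n w w' :
  past n w = past n w' <-> forall k i, (k <= n)%N -> B k w i = B k w' i.
Proof.
have Bn k v i : (k <= n)%N -> (B k v i < (\sum_j B0 j + n * #|E|).+1)%N.
  move=> kn; rewrite ltnS; apply: (@leq_trans (\sum_j B k v j)).
    by rewrite (bigD1 i)//= leq_addr.
  by rewrite balls_total// leq_add2l leq_mul2r kn orbT.
split=> [/ffunP e k i kn|e].
  have := e (inord k, i); rewrite !ffunE /= inordK ?ltnS// => /(congr1 val) /=.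
  by rewrite !inordK ?Bn.
apply/ffunP => -[k i]; rewrite !ffunE /=; congr inord; apply: e.
by rewrite -ltnS.
Qed.

Lemma balls_gt0 n w i : (0 < B n w i)%N.
Proof. by elim: n => [|n IH]; [exact: B0_gt0|exact: leq_trans IH (leq_addr _ _)]. Qed.

Lemma balls_measurable n i : measurable_fun setT (fun w => (B n w i)%:R : R).
Proof.
elim: n i => [|n IH] i; first exact: measurable_cst.
have -> : (fun w => (B n.+1 w i)%:R : R) = (fun w => (B n w i)%:R +
   \sum_(f in E | i \in f) \1_[set w | c n.+1 f w = i] w).
  apply/funext => w; rewrite ballsS// natrD natr_sum; congr (_ + _).
  apply: eq_bigr => f _; rewrite indicE; congr ((nat_of_bool _)%:R).
  by apply/eqP/idP; rewrite inE.
apply: measurable_funD => //.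
under eq_fun do rewrite big_mkcond.
apply: measurable_sum => f.
have [/andP[fE _]|_] := boolP ((f \in E) && (i \in f)); last exact: measurable_cst.
by apply/measurable_indicP; exact: c_meas.
Qed.

Lemma history_measurable n h : measurable (history E B0 c n h).
Proof.
have -> : history E B0 c n h =
    \bigcap_(k in [set k | (k <= n)%N]) \bigcap_i [set w | B k w i = h k i].
  by apply/seteqP; split => w /= H k => [kn i _|i kn]; [exact: H|exact: (H k kn i)].
apply: bigcap_measurable; first by exists 0%N.
move=> k _; apply: fin_bigcap_measurable => // i _.
have := @balls_measurable k i measurableT _ (measurable_set1 ((h k i)%:R : R)).
rewrite setTI; congr measurable; apply/seteqP; split => w /=.
  by move=> /eqP; rewrite eqr_nat => /eqP.
by move=> ->.
Qed.

Lemma past_history n w0 :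
  [set w | past n w = past n w0] = history E B0 c n (fun k i => B k w0 i).
Proof.
apply/seteqP; split => w /=; first by move/pastP => h k i; exact: h.
by move=> h; apply/pastP => k i; exact: h.
Qed.

Lemma past_measurable n t : measurable [set w | past n w = t].
Proof.
have [[w0 <-]|no] := pselect (exists w0, past n w0 = t).
  by rewrite past_history; exact: history_measurable.
suff -> : [set w | past n w = t] = classical_sets.set0 by exact: measurable0.
by apply/seteqP; split => w //= e; apply: no; exists w.
Qed.

Lemma past_refine n : factors_through (past n.+1) (past n).
Proof.
by move=> w w' /pastP h; apply/pastP => k i kn; apply: h; rewrite ltnW.
Qed.

Lemma growth_past i n : factors_through (past n.+1) (relative_growth i n).
Proof.
move=> w w' /pastP h; rewrite /relative_growth.
by rewrite (h n.+1 i (leqnn _)) (h n i (leqnSn _)).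
Qed.

Lemma rate_past i n : factors_through (past n) (fun w => rate (fun j => (B n w j)%:R) i).
Proof.
move=> w w' /pastP h; apply: eq_bigr => f _; congr (_^-1).
by apply: eq_bigr => j _; rewrite (h n j (leqnn _)).
Qed.

Lemma fluctuation_past i n : factors_through (past n.+1) (fluctuation i n).
Proof.
move=> w w' e; rewrite /fluctuation (growth_past _ e).
by rewrite (@rate_past i n w w') //; exact: past_refine.
Qed.

(** Given the past, each edge at a vertex feeds it with conditional probability
    proportional to its content, so the content of the vertex cancels in the
    expected relative growth. *)
Lemma edge_probability n w0 f i : f \in E -> i \in f ->
  let A := history E B0 c n (fun k j => B k w0 j) in
  fine (P ([set w | c n.+1 f w = i] `&` A)) / (B n w0 i)%:R
  = fine (P A) / load (fun j => (B n w0 j)%:R) f.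
Proof.
move=> fE fi A.
have mA : measurable A by exact: history_measurable.
have mAi : measurable ([set w | c n.+1 f w = i] `&` A).
  by apply: measurableI => //; exact: c_meas.
have [j ji fij] : exists2 j, j != i & f = [set i; j]%SET.
  have /eqP/cards2P[x [y [xy fxy]]] := gE fE.
  move: fi; rewrite fxy !inE => /orP[/eqP ->|/eqP ->].
    by exists y => //; rewrite eq_sym.
  by exists x => //; rewrite finset.setUC.
have b0 k : (B n w0 k)%:R != 0 :> R by rewrite pnatr_eq0 -lt0n balls_gt0.
have fsum : load (fun k => (B n w0 k)%:R) f = (B n w0 i + B n w0 j)%N%:R :> R.
  by rewrite /load fij big_setU1 ?inE 1?eq_sym//= big_set1 natrD.
rewrite fsum.
have [PA0|PA0] := eqVneq (P A) 0%E.
  have -> : P ([set w | c n.+1 f w = i] `&` A) = 0%E.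
    apply/eqP; rewrite -measure_le0 -PA0; apply: le_measure; rewrite ?inE//.
  by rewrite PA0 /= !mul0r.
have Ppos : (0 < P A)%E by rewrite lt0e PA0 measure_ge0.
have := fE; rewrite fij => ijE.
have := urn; move=> [_ _ /(_ n i j _ ijE Ppos)]; rewrite /cond_prob -fij => e.
have PAf : fine (P A) != 0 by rewrite fine_eq0// fin_num_measure.
have -> : fine (P ([set w | c n.+1 f w = i] `&` A)) =
   (B n w0 i)%:R / (B n w0 i + B n w0 j)%N%:R * fine (P A).
  by rewrite -e divfK.
have bij : (B n w0 i + B n w0 j)%:R != 0 :> R.
  by rewrite pnatr_eq0 addn_eq0 -leqn0 leqNgt balls_gt0.
by rewrite natrD in bij *; field; rewrite bij b0.
Qed.

Lemma fluctuation_centred i n t :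
  mean P (fun w => (past n w == t)%:R * fluctuation i n w) = 0.
Proof.
have [[w0 <-]|no] := pselect (exists w0, past n w0 = t); last first.
  rewrite (_ : (fun w => _) = cst 0) ?mean_cst//; apply/funext => w.
  by rewrite (_ : _ == _ = false) ?mul0r//; apply/eqP => e; apply: no; exists w.
pose A := history E B0 c n (fun k j => B k w0 j).
pose Ai f := [set w | c n.+1 f w = i] `&` A.
have mA : measurable A by exact: history_measurable.
have mAi f : f \in E -> measurable (Ai f).
  by move=> fE; apply: measurableI => //; exact: c_meas.
pose s (f : {set _}) : R := load (fun j => (B n w0 j)%:R) f.
(* on this past the contents are constants, and the only randomness left is in
   the indicators of the choices *)
have -> : (fun w => (past n w == past n w0)%:R * fluctuation i n w) =
    (fun w => \sum_(f in E | i \in f)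
       ((B n w0 i)%:R^-1 * \1_(Ai f) w - (s f)^-1 * \1_A w)).
  apply/funext => w; have [e|ne] := eqVneq (past n w) (past n w0); last first.
    have nA : (w \in A) = false.
      apply/negP; rewrite inE => Aw; move/eqP: ne; apply.
      by have : [set w | past n w = past n w0] w by rewrite past_history.
    rewrite mul0r big1// => f _; rewrite !indicE in_setI nA andbF.
    by rewrite !mulr0 subrr.
  have wA : w \in A.
    by rewrite inE /A -past_history.
  have Bw j : B n w j = B n w0 j by move/pastP: e; exact.
  rewrite mul1r /fluctuation /relative_growth sumrB; congr (_ - _).
    rewrite ballsS// natrD addrC addKr natr_sum mulr_suml Bw.
    apply: eq_bigr => f _; rewrite mulrC indicE in_setI wA andbT.
    by congr (_ * (nat_of_bool _)%:R); apply/eqP/idP; rewrite inE.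
  apply: eq_bigr => f _; rewrite indicE wA mulr1; congr (_^-1).
  by apply: eq_bigr => j _; rewrite Bw.
have intZ a X : measurable X ->
    P.-integrable setT (EFin \o (fun w => a * \1_X w : R)).
  by move=> mX; have := integrableZl measurableT a (integrable_indic P mX).
have meanZ1 a X : measurable X ->
    mean P (fun w => a * \1_X w : R) = a * fine (P X).
  move=> mX; rewrite /mean RintegralZl//; last exact: integrable_indic.
  by rewrite -/(mean P _) mean_indicator.
rewrite mean_sum => [|f /andP[fE fi]]; last first.
  by have := integrableB measurableT (intZ (B n w0 i)%:R^-1 _ (mAi f fE))
    (intZ (s f)^-1 _ mA).
rewrite big1// => f /andP[fE fi].
rewrite /mean RintegralB//; [|by apply: intZ => //; exact: mAi|exact: intZ].
rewrite -!/(mean P _) !meanZ1//; last exact: mAi.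
by rewrite mulrC edge_probability// mulrC subrr.
Qed.

Lemma fluctuation_martingale i :
  centred_increments P past (fluctuation i).
Proof.
split.
- exact: past_measurable.
- exact: past_refine.
- exact: fluctuation_past.
- exact: fluctuation_centred.
Qed.

Lemma balls_slow i w k :
  let b k : R := (B k w i)%:R in b k <= b k.+1 <= b k + #|E|%:R.
Proof. by rewrite /= -natrD !ler_nat balls_mono balls_step. Qed.

(** The squares of the relative growths have a bounded sum along every
    realization, and centring only decreases second moments. *)
Lemma fluctuation_sqr_sum i n :
  \sum_(k < n) mean P (fun w => fluctuation i k w ^+ 2)
    <= #|E|%:R * (#|E|%:R + 1).
Proof.
pose X2 k w := relative_growth i k w ^+ 2.
have mp k := @past_measurable k.
have X2p k : factors_through (past k.+1) (X2 k).
  by move=> w w' e; rewrite /X2 (growth_past _ e).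
have F2p k : factors_through (past k.+1) (fun w => fluctuation i k w ^+ 2).
  by move=> w w' e; rewrite (fluctuation_past _ e).
have step k : mean P (fun w => fluctuation i k w ^+ 2) <= mean P (X2 k).
  (* square of growth = rate + fluctuation; the cross term is centred because
     the rate is known from the past *)
  pose r w := 2 * rate (fun j => (B k w j)%:R) i.
  have rp : factors_through (past k) r.
    by move=> w w' e; rewrite /r; have /= -> := rate_past i e.
  have rFp : factors_through (past k.+1) (fun w => r w * fluctuation i k w).
    by move=> w w' e; rewrite (fluctuation_past _ e) (rp w w')//; exact: past_refine.
  have r0 := mean_mul0 (mp k.+1) (@past_refine k) (@fluctuation_past i k)
    (@fluctuation_centred i k) rp.
  rewrite -[leLHS]addr0 -r0 -(meanD P (mp k.+1) (F2p k) rFp).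
  apply: (le_mean P (mp k.+1)); [|exact: X2p|].
    by move=> w w' e; rewrite (F2p k _ _ e) (rFp _ _ e).
  move=> w; rewrite /X2 /r /fluctuation.
  set x := relative_growth _ _ _; set y := rate _ _.
  have -> : (x - y) ^+ 2 + 2 * y * (x - y) = x ^+ 2 - y ^+ 2 by ring.
  by rewrite gerBl sqr_ge0.
apply: (@le_trans _ _ (\sum_(k < n) mean P (X2 k))).
  by apply: ler_sum => k _; exact: step.
have Xn (k : 'I_n) : factors_through (past n) (X2 k).
  by move=> w w' e; apply: X2p; exact: (refine_le (fluctuation_martingale i) (ltn_ord k)).
rewrite -mean_sum; last by move=> k _; apply: (integrable_level P (mp n)); exact: Xn.
rewrite -[leRHS](mean_cst P); apply: (le_mean P (mp n)); [|by []|].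
  by move=> w w' e; apply: eq_bigr => k _; exact: Xn.
move=> w; apply: (relative_increment_sqr_sum (b := fun k => (B k w i)%:R)) => //.
- by rewrite ler1n balls_gt0.
- by move=> k; exact: balls_slow.
Qed.

(** The martingale compares the accumulated rates with the relative growths, and
    slow growth compares the relative growths with the logarithm. *)
Lemma ln_balls_sub_rates_cvg :
  {ae P, forall w, forall i, cvgn (fun n =>
    ln ((B n w i)%:R : R) - \sum_(k < n) rate (fun j => (B k w j)%:R) i)}.
Proof.
apply: filter_forall => i.
apply: filterS (martingale_cvg (fluctuation_martingale i) (fluctuation_sqr_sum i)) => w.
have := ln_sub_relative_increments_cvg (b := fun k => (B k w i)%:R : R)
  (a := #|E|%:R) (ler0n _ _).
rewrite ler1n balls_gt0 => /(_ isT (balls_slow i w)) c1 c2.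
apply: eq_cvgn (is_cvgD c1 c2) => n; rewrite fctE /=.
rewrite /fluctuation sumrB; lra.
Qed.

End UrnMartingale.

(** * Maximizing the product of the loads *)

Section Equilibria.
Context (R : realType) (m : nat) (E : {set {set 'I_m}}).

Definition simplex : set 'rV[R]_m :=
  [set x | (forall i, 0 <= x 0 i) /\ \sum_i x 0 i = 1].

(** Directional derivative at [x] towards [v] of the sum of the logarithms of
    the loads. *)
Definition gap (v x : 'I_m -> R) : R :=
  \sum_(f in E) (load v f / load x f - 1).

Lemma load_continuous f : continuous (fun x : 'rV[R]_m => load (x 0) f).
Proof.
move=> x; rewrite /load; apply: (cvg_sumr (F := nbhs x)) => i _; exact: coord_continuous.
Qed.

Lemma simplex_compact : compact simplex.
Proof.
have cK : compact [set x : 'rV[R]_m | forall i, x ord0 i \in `[0, 1]].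
  have := @rV_compact R m (fun=> `[0, 1]%classic).
  by apply=> i; exact: segment_compact.
apply: (subclosed_compact _ cK).
  have -> : simplex = (\bigcap_i [set x : 'rV[R]_m | 0 <= x 0 i]) `&`
      (fun x : 'rV[R]_m => load (x 0) [set: 'I_m]%SET) @^-1` [set 1].
    have loadT x : load x [set: 'I_m]%SET = \sum_i x i.
      by apply: eq_bigl => i; rewrite inE.
    apply/seteqP; split => x /=; rewrite loadT => -[h1 h2]; split=> // i.
      by move=> _; exact: h1.
    exact: (h1 i I).
  apply: closedI; last first.
    by apply: closed_comp; [move=> x _; exact: load_continuous|exact: closed_eq].
  apply: closed_bigI => i _.
  apply: (@closed_comp _ _ (fun x : 'rV[R]_m => x 0 i) [set y | 0 <= y]).
    by move=> x _; exact: coord_continuous.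
  exact: closed_ge.
move=> x [x0 x1] i /=; rewrite in_itv/= x0/= -x1 (bigD1 i)//= lerDl.
by apply: sumr_ge0.
Qed.

Definition load_maximizer (v : 'rV[R]_m) : Prop :=
  [/\ simplex v, forall f, f \in E -> 0 < load (v 0) f &
  forall x, simplex x ->
    \prod_(f in E) load (x 0) f <= \prod_(f in E) load (v 0) f].

(** At the uniform vector every load is positive, hence also the maximum of the
    product, so that no load vanishes at a maximizer. *)
Lemma load_maximizer_exists :
  (0 < m)%N -> simple_graph E -> exists v, load_maximizer v.
Proof.
move=> m0 gE.
pose u : 'rV[R]_m := const_mx m%:R^-1.
have mR : m%:R != 0 :> R by rewrite pnatr_eq0 -lt0n.
have uS : simplex u.
  split=> [i|]; first by rewrite mxE invr_ge0.
  under eq_bigr do rewrite mxE.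
  by rewrite sumr_const card_ord -[LHS]mulr_natr mulVf.
have u0 f : f \in E -> 0 < load (u 0) f.
  move=> fE; rewrite /load; under eq_bigr do rewrite mxE.
  by rewrite sumr_const (gE _ fE) pmulrn_lgt0// invr_gt0 ltr0n.
have cont : continuous (fun x : 'rV[R]_m => \prod_(f in E) load (x 0) f).
  move=> x; apply: (@cvg_big _ _ _ _ _ _ _ (nbhs x)) => //; first exact: mul_continuous.
  by move=> f _; exact: load_continuous.
have [v] := EVT_max_rV (ex_intro _ u uS) simplex_compact (continuous_subspaceT cont).
rewrite inE => vS vmax; exists v; split=> //; last first.
  by move=> x xS; apply: vmax; rewrite inE.
have v_ge0 f : 0 <= load (v 0) f by apply: sumr_ge0 => i _; case: vS.
have vP : 0 < \prod_(f in E) load (v 0) f.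
  apply: (@lt_le_trans _ _ (\prod_(f in E) load (u 0) f)); first exact: prodr_gt0.
  by apply: vmax; rewrite inE.
move=> f fE; rewrite lt0r v_ge0 andbT; apply/negP => /eqP f0.
by move: vP; rewrite (bigD1 f)//= f0 mul0r ltxx.
Qed.

Lemma ln_prod (I : Type) (r : seq I) (p : pred I) (F : I -> R) :
  (forall i, p i -> 0 < F i) ->
  ln (\prod_(i <- r | p i) F i) = \sum_(i <- r | p i) ln (F i).
Proof.
move=> F0; elim: r => [|i r IH]; first by rewrite !big_nil ln1.
rewrite !big_cons; case: ifP => // pi.
by rewrite lnM ?IH// posrE ?F0// prodr_gt0.
Qed.

Lemma ln_eq_sub1 (r : R) : 0 < r -> r - 1 <= ln r -> r = 1.
Proof.
move=> r0 h; apply/eqP; rewrite -ln_eq0//; apply: contraLR h => /expR_gt1Dx.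
by rewrite lnK ?posrE// -ltNge ltrBrDr addrC.
Qed.

Section Gap.
Variables (v x : 'rV[R]_m).
Hypothesis bv : load_maximizer v.
Hypothesis xS : simplex x.
Hypothesis x0 : forall f, f \in E -> 0 < load (x 0) f.

Let ratio_gt0 f : f \in E -> 0 < load (v 0) f / load (x 0) f.
Proof. by move=> fE; case: bv => _ v0 _; rewrite divr_gt0 ?x0 ?v0. Qed.

Let ln_ratio_ge0 : 0 <= \sum_(f in E) ln (load (v 0) f / load (x 0) f).
Proof.
rewrite -ln_prod//; apply: ln_ge0; rewrite prodf_div ler_pdivlMr ?prodr_gt0//.
by rewrite mul1r; case: bv => _ _; exact.
Qed.

(** Maximality of the product of the loads enters through its logarithm, via
    [ln r <= r - 1]. *)
Lemma gap_ge0 : 0 <= gap (v 0) (x 0).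
Proof.
apply: le_trans ln_ratio_ge0 _; apply: ler_sum => f fE.
exact/ln_le_sub1/ratio_gt0.
Qed.

(** Equality in [ln r <= r - 1] holds for [r = 1] only. *)
Lemma gap_le0_load f : gap (v 0) (x 0) <= 0 -> f \in E ->
  load (x 0) f = load (v 0) f.
Proof.
move=> g0 fE.
suff : load (v 0) f / load (x 0) f = 1 by move/divr1_eq.
apply: ln_eq_sub1; first exact: ratio_gt0.
have le_term h : h \in E ->
    0 <= load (v 0) h / load (x 0) h - 1 - ln (load (v 0) h / load (x 0) h).
  by move=> hE; rewrite subr_ge0; exact/ln_le_sub1/ratio_gt0.
have : \sum_(h in E) (load (v 0) h / load (x 0) h - 1
                        - ln (load (v 0) h / load (x 0) h)) <= 0.
  by rewrite sumrB subr_le0 (le_trans g0).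
rewrite (bigD1 f)//= => le0; rewrite -subr_le0; apply: le_trans le0.
by rewrite lerDl sumr_ge0// => h /andP[hE _]; exact: le_term.
Qed.

End Gap.
End Equilibria.

(** * The two sides of the graph *)

Section Sides.
Context (R : realType) (m : nat) (E : {set {set 'I_m}}) (A B : {set 'I_m}).
Hypothesis gE : simple_graph E.
Hypothesis AB : bipartition E A B.

Definition side (i : 'I_m) : R := if i \in A then 1 else -1.

Lemma edge_pair f : f \in E -> exists i j, i != j /\ f = [set i; j]%SET.
Proof. by move=> /gE/eqP/cards2P. Qed.

Lemma load_pair (x : 'I_m -> R) i j : i != j ->
  load x [set i; j]%SET = x i + x j.
Proof. by move=> ij; rewrite /load big_setU1 ?inE//= big_set1. Qed.

Let in_B i : (i \in B) = (i \notin A).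
Proof.
case: AB => /finset.setP/(_ i) + /finset.setP/(_ i) + _; rewrite !inE.
by case: (i \in A); case: (i \in B).
Qed.

Lemma load_side f : f \in E -> load side f = 0.
Proof.
move=> fE; have [i [j [ij fij]]] := edge_pair fE.
rewrite fij load_pair// /side; case: AB => _ _ /(_ i j).
rewrite -fij => /(_ fE); rewrite !in_B.
by case=> [[-> /negbTE ->]|[/negbTE -> ->]]; rewrite ?subrr ?addNr.
Qed.

Lemma sum_side : #|A| = #|B| -> \sum_i side i = 0.
Proof.
move=> cAB; rewrite (bigID (mem A))/=.
rewrite (eq_bigr (fun=> 1)) => [|i iA]; last by rewrite /side iA.
rewrite [X in _ + X](eq_bigl (mem B)) => [|i]; last by rewrite /= in_B.
rewrite [X in _ + X](eq_bigr (fun=> -1)) => [|i]; last first.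
  by rewrite /= in_B /side => /negbTE ->.
by rewrite !sumr_const cAB mulNrn subrr.
Qed.

Lemma connected_invariant (T : Type) (g : 'I_m -> T) :
  connected_graph E -> (forall i j, Defs.adjacent E i j -> g i = g j) ->
  forall i j, g i = g j.
Proof.
move=> cE inv i j; have /connectP[p + ->] := cE i j.
by elim: p i => //= k p IH i /andP[/inv -> /IH].
Qed.

(** A weighting that vanishes on every edge changes sign along each edge, so
    on a connected bipartite graph only the difference of the two sides is
    left. *)
Lemma load_eq0_side (z : 'I_m -> R) : connected_graph E ->
  (forall f, f \in E -> load z f = 0) ->
  forall i0 i, z i = z i0 * side i0 * side i.
Proof.
move=> cE z0 i0 i.
have ss j : side j * side j = 1 by rewrite /side; case: ifP; rewrite ?mulrNN mulr1.
have : z i0 * side i0 = z i * side i.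
  apply: (@connected_invariant _ (fun j => z j * side j)) => // j k jk.
  have jk' : j != k.
    by apply/eqP => e; move: (gE jk); rewrite e finset.setUid cards1.
  have := z0 _ jk; have := load_side jk; rewrite !load_pair//.
  move=> /eqP; rewrite addr_eq0 => /eqP -> /eqP; rewrite addr_eq0 => /eqP ->.
  by rewrite mulrNN.
by move=> ->; rewrite -mulrA ss mulr1.
Qed.

End Sides.

(** * Relative entropy and cluster points *)

Section Hellinger.
Context {R : realType}.

(** With [a = sqrt w] and [b = sqrt x], [ln (b / a) <= b / a - 1] gives
    [w ln (w / x) - w + x >= (a - b) ^+ 2], and [a + b <= 2]. *)
Lemma sqr_dist_le_entropy (w x : R) : 0 <= w <= 1 -> 0 < x <= 1 ->
  (w - x) ^+ 2 <= 4 * (w * ln w - w * ln x - w + x).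
Proof.
move=> /andP[w0 w1] /andP[x0 x1].
have [->|wn0] := eqVneq w 0.
  by rewrite !mul0r subrr !sub0r oppr0 add0r sqrrN; nra.
have wpos : 0 < w by rewrite lt0r wn0.
pose a := Num.sqrt w; pose b := Num.sqrt x.
have a0 : 0 < a by rewrite sqrtr_gt0.
have b0 : 0 < b by rewrite sqrtr_gt0.
have wa : w = a ^+ 2 by rewrite sqr_sqrtr.
have xb : x = b ^+ 2 by rewrite sqr_sqrtr// ltW.
have a1 : a <= 1 by rewrite -sqrtr1 ler_wsqrtr.
have b1 : b <= 1 by rewrite -sqrtr1 ler_wsqrtr.
have l : ln b - ln a <= b / a - 1.
  by rewrite -ln_div ?posrE//; apply: ln_le_sub1; rewrite divr_gt0.
have {}l : a ^+ 2 * (ln b - ln a) <= a * b - a ^+ 2.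
  have -> : a * b - a ^+ 2 = a ^+ 2 * (b / a - 1) by field; rewrite gt_eqF.
  by rewrite ler_wpM2l// sqr_ge0.
have -> : ln w = 2 * ln a by rewrite wa lnXn// mulr_natl.
have -> : ln x = 2 * ln b by rewrite xb lnXn// mulr_natl.
rewrite wa xb.
apply: (@le_trans _ _ (4 * (a - b) ^+ 2)).
  have -> : (a ^+ 2 - b ^+ 2) ^+ 2 = (a + b) ^+ 2 * (a - b) ^+ 2 by ring.
  by rewrite ler_wpM2r ?sqr_ge0//; nra.
rewrite ler_pM2l//.
have -> : (a - b) ^+ 2 = a ^+ 2 - 2 * (a * b) + b ^+ 2 by ring.
have -> : a ^+ 2 * (2 * ln a) - a ^+ 2 * (2 * ln b) - a ^+ 2 + b ^+ 2
  = - 2 * (a ^+ 2 * (ln b - ln a)) - a ^+ 2 + b ^+ 2 by ring.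
lra.
Qed.

End Hellinger.

(** A filter finer than that of the sequence converges to the cluster point, and
    [h] has both limits along it. *)
Lemma cluster_cvg_value {R : realType} {T : topologicalType} (x : nat -> T)
    (w : T) (h : T -> R) (l : R) :
  cluster (x @ \oo) w -> h y @[y --> w] --> h w ->
  h (x n) @[n --> \oo] --> l -> h w = l.
Proof.
rewrite cluster_cvgE => -[G PG [Gw xG]] hw hl.
have h1 : h y @[y --> G] --> h w by apply: cvg_trans hw; exact: cvg_app.
have h2 : h y @[y --> G] --> l.
  by apply: cvg_trans hl => A; exact: xG.
exact: (cvg_unique _ h1 h2).
Qed.

Lemma cluster_closed {T : topologicalType} (x : nat -> T) (w : T) (C : set T) :
  closed C -> (forall n, C (x n)) -> cluster (x @ \oo) w -> C w.
Proof.
move=> cC Cx xw; apply: cC => V /xw; apply.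
by exists 0%N => // n _; exact: Cx.
Qed.

(** * Convergence of a realization *)

Section Trajectory.
Context (R : realType) (m : nat) (E : {set {set 'I_m}}) (A B : {set 'I_m}).
Hypothesis m_gt0 : (0 < m)%N.
Hypothesis gE : simple_graph E.
Hypothesis cE : connected_graph E.
Hypothesis AB : bipartition E A B.
Hypothesis cardAB : #|A| = #|B|.
(* One realization of the contents on which the logarithms of the bins follow
   their compensators up to convergent errors. *)
Variable b : nat -> 'I_m -> R.
Hypothesis b_ge1 : forall n i, 1 <= b n i.
Hypothesis b_total : forall n, \sum_i b n.+1 i = \sum_i b n i + #|E|%:R.
Hypothesis b_edge : forall n f, f \in E -> n%:R <= load (b n) f.
Hypothesis b_compensated : forall i,
  cvgn (fun n => ln (b n i) - \sum_(k < n) rate E (b k) i).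

Let N : R := #|E|%:R.
Let S n := \sum_i b n i.
Let x n : 'rV[R]_m := \row_i (b n i / S n).

Let b_gt0 n i : 0 < b n i.
Proof. exact: lt_le_trans (b_ge1 n i). Qed.

Let b_leS n i : b n i <= S n.
Proof. by rewrite /S (bigD1 i)//= lerDl sumr_ge0// => j _; exact: ltW. Qed.

Let S_ge1 n : 1 <= S n.
Proof. exact: le_trans (b_ge1 n (Ordinal m_gt0)) (b_leS n _). Qed.

Let S_gt0 n : 0 < S n.
Proof. exact: lt_le_trans (S_ge1 n). Qed.

Let S_eq n : S n = S 0 + n%:R * N.
Proof.
elim: n => [|n IH]; first by rewrite mul0r addr0.
by rewrite /S b_total -/(S n) IH -natr1 mulrDl mul1r addrA.
Qed.

Let xE n i : x n 0 i = b n i / S n.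
Proof. by rewrite mxE. Qed.

Let x_gt0 n i : 0 < x n 0 i.
Proof. by rewrite xE divr_gt0. Qed.

Let x_le1 n i : x n 0 i <= 1.
Proof. by rewrite xE ler_pdivrMr// mul1r. Qed.

Let x_simplex n : simplex (x n).
Proof.
split=> [i|]; first exact: ltW.
under eq_bigr do rewrite xE.
by rewrite -mulr_suml -/(S n) divff ?gt_eqF.
Qed.

Let x_load n f : load (x n 0) f = load (b n) f / S n.
Proof. by rewrite /load mulr_suml; apply: eq_bigr => i _; rewrite xE. Qed.

Let load_gt0 n f : f \in E -> 0 < load (b n) f.
Proof.
move=> fE; have [i [j [ij ->]]] := edge_pair gE fE.
by rewrite load_pair// addr_gt0.
Qed.

Let x_load_gt0 n f : f \in E -> 0 < load (x n 0) f.
Proof. by move=> fE; rewrite x_load divr_gt0 ?load_gt0. Qed.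

Let x_load_lb n f : f \in E -> (S 0 + N)^-1 <= load (x n.+1 0) f.
Proof.
move=> fE; rewrite x_load ler_pdivlMr// [S n.+1]S_eq.
have N0 : 0 <= N by rewrite ler0n.
have S0 := S_ge1 0; have n0 : 0 <= n%:R :> R by rewrite ler0n.
apply: le_trans (b_edge n.+1 fE).
rewrite mulrC ler_pdivrMr; last by lra.
have nS : 0 <= n%:R * S 0 by rewrite mulr_ge0// ltW.
rewrite -natr1; lra.
Qed.

(** Weighting the compensators of the bins by [u] turns sums over bins into
    sums over edges, where only the loads of [u] matter. *)
Let weighted_rate (u c : 'I_m -> R) :
  \sum_i u i * rate E c i = \sum_(f in E) load u f / load c f.
Proof.
under eq_bigr do rewrite /rate big_mkcondr mulr_sumr.
rewrite exchange_big/=; apply: eq_bigr => f _.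
rewrite /load mulr_suml [RHS]big_mkcond/=; apply: eq_bigr => i _.
by case: ifP; rewrite ?mulr0.
Qed.

Let weighted_ln_cvg (u : 'I_m -> R) : cvgn (fun n =>
  \sum_i u i * ln (b n i) - \sum_(k < n) \sum_(f in E) load u f / load (b k) f).
Proof.
have : cvgn (fun n => \sum_i u i * (ln (b n i) - \sum_(k < n) rate E (b k) i)).
  by apply: is_cvg_sumr => i _; apply: is_cvgMr; exact: b_compensated.
apply: eq_cvgn => n; under eq_bigr do rewrite mulrBr mulr_sumr.
rewrite sumrB; congr (_ - _); rewrite exchange_big/=.
by apply: eq_bigr => k _; rewrite weighted_rate.
Qed.

Let lnS_cvg : cvgn (fun n => ln (S n) - \sum_(k < n) N / S k).
Proof.
have SS k : S k.+1 = S k + N by exact: b_total.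
have step k : S k <= S k.+1 <= S k + N by rewrite SS lexx lerDl ler0n.
apply: eq_cvgn (ln_sub_relative_increments_cvg (ler0n _ _) (S_ge1 0) step) => n.
congr (_ - _); apply: eq_bigr => k _.
by rewrite SS addrC addKr.
Qed.

Variable v : 'rV[R]_m.
Hypothesis bv : load_maximizer E v.

Let v_simplex : simplex v. Proof. by case: bv. Qed.

Let lnx n i : ln (x n 0 i) = ln (b n i) - ln (S n).
Proof. by rewrite xE ln_div ?posrE. Qed.

Let lost n := \sum_(k < n) gap E (v 0) (x k 0) / S k.

Let gapx_ge0 n : 0 <= gap E (v 0) (x n 0).
Proof. by apply: (gap_ge0 bv) => // f; exact: x_load_gt0. Qed.

(** Lyapunov function: the relative entropy of [v] with respect to [x n] is,
    up to a convergent sequence, minus the accumulated gap. *)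
Let entropy_lost_cvg :
  cvgn (fun n => \sum_i v 0 i * ln (x n 0 i) - lost n).
Proof.
have c1 := @weighted_ln_cvg (v 0); have c2 := lnS_cvg.
apply: eq_cvgn (is_cvgB c1 c2) => n; rewrite fctE /=.
have -> : \sum_i v 0 i * ln (x n 0 i) = \sum_i v 0 i * ln (b n i) - ln (S n).
  under eq_bigr do rewrite lnx mulrBr.
  by rewrite sumrB -mulr_suml; have [_ ->] := v_simplex; rewrite mul1r.
have -> : lost n = \sum_(k < n) \sum_(f in E) load (v 0) f / load (b k) f
                   - \sum_(k < n) N / S k.
  rewrite -sumrB; apply: eq_bigr => k _.
  rewrite /gap mulr_suml /N -sum1_card natr_sum mulr_suml -sumrB.
  apply: eq_bigr => f fE; rewrite x_load.
  by field; rewrite !gt_eqF// load_gt0.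
rewrite !fctE /=; lra.
Qed.

Let lost_cvg : cvgn lost.
Proof.
have /cvg_seq_bounded [M [_ hM]] := entropy_lost_cvg.
apply: nondecreasing_is_cvgn.
  apply/nondecreasing_seqP => n; rewrite /lost big_ord_recr/= lerDl.
  by rewrite divr_ge0// ltW.
exists (M + 1) => _ [n _ <-].
have M1 : M < M + 1 by rewrite ltrDl.
have := hM _ M1 n I => /=.
have : \sum_i v 0 i * ln (x n 0 i) <= 0.
  apply: sumr_le0 => i _; apply: mulr_ge0_le0; first by case: v_simplex.
  exact: ln_le0.
rewrite ler_norml => h1 /andP[h2 _]; lra.
Qed.

Let entropy_cvg : cvgn (fun n => \sum_i v 0 i * ln (x n 0 i)).
Proof.
apply: eq_cvgn (is_cvgD entropy_lost_cvg lost_cvg) => n.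
by rewrite fctE /= subrK.
Qed.

(** Each edge has one end on each side, so the compensators cancel; the sides
    have equal size, so normalizing by [S n] changes nothing. *)
Let side_cvg : cvgn (fun n => \sum_i side R A i * ln (x n 0 i)).
Proof.
apply: eq_cvgn (@weighted_ln_cvg (side R A)) => n.
rewrite [X in _ - X]big1 ?subr0 => [|k _]; last first.
  by rewrite big1// => f fE; rewrite (load_side _ gE AB)// mul0r.
under [RHS]eq_bigr do rewrite lnx mulrBr.
by rewrite sumrB -mulr_suml (sum_side _ AB)// mul0r subr0.
Qed.

(** The accumulated gap converges while its weights [1 / S k] have a divergent
    sum, so the gap is small infinitely often. *)
Let gap_small (e : R) n0 : 0 < e ->
  exists2 n, (n0 <= n)%N & gap E (v 0) (x n 0) < e.
Proof.
move=> e0; apply: contrapT => no.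
have ge n : (n0 <= n)%N -> e <= gap E (v 0) (x n 0).
  by move=> n0n; rewrite leNgt; apply/negP => lt; apply: no; exists n.
pose c := e / (S 0 + N).
have SN0 : 0 < S 0 + N by rewrite ltr_wpDr// ler0n.
have c0 : 0 < c by rewrite divr_gt0.
(* two errors below [c / 5] cannot make up a difference of [c / 2] *)
have c4 : 0 < c / 5 by rewrite divr_gt0.
have /cvgrPdist_lt/(_ _ c4)[n1 _ hn1] := lost_cvg.
pose n := (maxn n0 n1).+1.
have n0n : (n0 <= n)%N by rewrite leqW// leq_maxl.
have n1n : (n1 <= n)%N by rewrite leqW// leq_maxr.
(* the block from n to 2n contributes at least n * (c / (2n)) *)
have block : c / 2 <= lost (n + n)%N - lost n.
  rewrite /lost big_split_ord/= addrAC subrr add0r.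
  apply: (@le_trans _ _ (\sum_(k < n) c / (2 * n%:R))).
    rewrite sumr_const card_ord -[leRHS]mulr_natr le_eqVlt; apply/orP; left.
    by apply/eqP; field; rewrite pnatr_eq0.
  apply: ler_sum => k _.
  have nk : (n <= n + k)%N by rewrite leq_addr.
  have Snk : S (n + k)%N <= (S 0 + N) * (2 * n%:R).
    have kn : (n + k)%N%:R <= 2 * n%:R :> R.
      by rewrite -natrM ler_nat mul2n -addnn leq_add2l ltnW.
    have n1' : 1 <= n%:R :> R by rewrite ler1n.
    have N0 : 0 <= N by rewrite ler0n.
    rewrite S_eq; apply: (@le_trans _ _ (S 0 + 2 * n%:R * N)).
      by rewrite lerD2l ler_wpM2r.
    have := S_gt0 0; move: (S 0) => s s0; nra.
  apply: (@le_trans _ _ (e / S (n + k)%N)); last first.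
    by rewrite ler_pM2r ?invr_gt0// ge// (leq_trans n0n).
  have n2 : 0 < 2 * n%:R :> R by rewrite mulr_gt0// ltr0n.
  by rewrite /c -mulrA -invfM ler_pM2l// lef_pV2 ?posrE// mulr_gt0.
have := hn1 (n + n)%N (leq_trans n1n (leq_addr _ _)); have := hn1 n n1n.
rewrite /= !ltr_norml => /andP[h1 h2] /andP[h3 h4].
by lra.
Qed.

(** A cluster point [w] of a subsequence along which the gap vanishes has the
    loads of [v], hence lies on the segment through [v] in the direction of
    the sides. The relative entropy of [w] with respect to [x n] is, up to a
    constant, a combination of two convergent sequences and tends to 0 along a
    further subsequence, so it tends to 0 and forces [x n] to converge to [w]. *)
Lemma trajectory_cvg : exists2 w : 'rV[R]_m,
  [set (1 - t) *: (v - \row_i side R A i) + t *: (v + \row_i side R A i)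
     | t in [set t : R | 0 <= t <= 1]] w &
  x n @[n --> \oo] --> w.
Proof.
(* times [n.+1], as the uniform lower bound on the loads starts at time 1 *)
have small k : exists n, gap E (v 0) (x n.+1 0) < k.+1%:R^-1 /\ (k <= n)%N.
  have [|[//|n] kn gn] := @gap_small k.+1%:R^-1 k.+1; first by rewrite invr_gt0.
  by exists n.
pose phi k := (projT1 (cid (small k))).+1.
have phiP k : gap E (v 0) (x (phi k) 0) < k.+1%:R^-1 by rewrite /phi; case: cid => n [].
have phik k : (k <= phi k)%N by rewrite /phi; case: cid => n [gn kn] /=; exact: leqW.
have phioo : phi @ \oo --> \oo.
  by move=> U [n _ nU]; exists n => // k /= nk; apply: nU => /=; exact: leq_trans (phik k).
have [w [wS wX]] : @simplex R m `&` cluster ((x \o phi) @ \oo) !=set0.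
  by apply: simplex_compact; exists 0%N => // k _; exact: x_simplex.
have [w0 w1] := wS.
have wload f : f \in E -> 0 < load (w 0) f.
  move=> fE; apply: (@lt_le_trans _ _ (S 0 + N)^-1).
    by rewrite invr_gt0 ltr_wpDr// ler0n.
  apply: (@cluster_closed _ (x \o phi) w [set y | (S 0 + N)^-1 <= load (y 0) f]) => //.
    apply: (@closed_comp _ _ (fun y : 'rV[R]_m => load (y 0) f) [set z | (S 0 + N)^-1 <= z]).
      by move=> y _; exact: load_continuous.
    exact: closed_ge.
  by move=> k; exact: x_load_lb.
have gap_cont : gap E (v 0) (y 0) @[y --> w] --> gap E (v 0) (w 0).
  apply: (cvg_sumr (F := nbhs w)) => f fE; apply: cvgB; last exact: cvg_cst.
  apply: cvgM; first exact: cvg_cst.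
  by apply: cvgV; [rewrite gt_eqF// wload|exact: load_continuous].
have gap0 : gap E (v 0) (w 0) = 0.
  apply: (cluster_cvg_value wX gap_cont).
  apply: (@squeeze_cvgr _ _ _ _ (fun=> 0) (fun k => k.+1%:R^-1)).
  - by near=> k; apply/andP; split; [exact: gapx_ge0|exact/ltW/phiP].
  - exact: cvg_cst.
  - exact: cvg_harmonic.
have wv f : f \in E -> load (w 0) f = load (v 0) f.
  by apply: (gap_le0_load bv wS wload); rewrite gap0.
pose i0 := Ordinal m_gt0.
pose t := (w 0 i0 - v 0 i0) * side R A i0.
have wE i : w 0 i = v 0 i + t * side R A i.
  have z0 f : f \in E -> load (fun i => w 0 i - v 0 i) f = 0.
    by move=> fE; rewrite /load sumrB -!/(load _ _) wv// subrr.
  by rewrite /t -(load_eq0_side gE AB cE z0 i0 i) addrC subrK.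
have in01 (y : 'rV[R]_m) i : simplex y -> 0 <= y 0 i <= 1.
  by move=> [y0 y1]; rewrite y0 -y1 (bigD1 i)//= lerDl sumr_ge0.
exists w.
  (* coordinates lie in [0, 1], so [`|t| <= 1] *)
  exists ((1 + t) / 2) => /=.
    have /andP[? ?] := in01 w i0 wS; have /andP[? ?] := in01 v i0 v_simplex.
    by rewrite /t /side; case: ifP => _; apply/andP; split; lra.
  by apply/rowP => i; rewrite !mxE wE; field.
pose h (y : 'rV[R]_m) := \sum_i w 0 i * ln (y 0 i).
(* a coordinate with [w 0 i = 0] contributes a constant, although [ln] is not
   continuous there *)
have h_cont : h y @[y --> w] --> h w.
  apply: (cvg_sumr (F := nbhs w)) => i _.
  have [->|wi] := eqVneq (w 0 i) 0.
    by under eq_cvg do rewrite mul0r; rewrite mul0r; exact: cvg_cst.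
  apply: cvgM; first exact: cvg_cst.
  have wpos : 0 < w 0 i by rewrite lt0r wi w0.
  by apply: continuous_cvg; [exact: continuous_ln|exact: coord_continuous].
have hx_cvg : cvgn (h \o x).
  have c : cvgn (fun n => t * \sum_i side R A i * ln (x n 0 i)).
    by apply: is_cvgMr; exact: side_cvg.
  apply: (eq_cvgn _ (is_cvgD entropy_cvg c)) => n; rewrite fctE /= /h mulr_sumr -big_split/=.
  by apply: eq_bigr => i _; rewrite wE mulrDl mulrA.
have hw : h w = limn (h \o x).
  apply: (cluster_cvg_value wX h_cont).
  exact: (cvg_comp _ _ phioo hx_cvg).
have D0 : h w - h (x n) @[n --> \oo] --> 0.
  rewrite -(subrr (h w)); apply: cvgB; first exact: cvg_cst.
  by rewrite hw.
have entropy n i : (w 0 i - x n 0 i) ^+ 2 <= 4 * (h w - h (x n)).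
  have -> : h w - h (x n) =
      \sum_j (w 0 j * ln (w 0 j) - w 0 j * ln (x n 0 j) - w 0 j + x n 0 j).
    rewrite big_split/= !sumrB w1; have [_ ->] := x_simplex n.
    by rewrite subrK.
  have ent j := sqr_dist_le_entropy (in01 w j wS)
    (introT andP (conj (x_gt0 n j) (x_le1 n j))).
  apply: le_trans (ent i) _; rewrite ler_pM2l// (bigD1 i)//= lerDl sumr_ge0// => j _.
  by have := le_trans (sqr_ge0 _) (ent j); rewrite pmulr_rge0.
apply/cvg_ballP => e e0; near=> n; split=> // i j.
rewrite ord1 /ball /=.
rewrite -(@ltr_pXn2r _ 2)// ?nnegrE ?ltW//.
rewrite real_normK ?num_real//; apply: le_lt_trans (entropy n j) _.
rewrite -ltr_pdivlMl//.
by near: n; apply: (cvgr_lt _ D0); rewrite mulr_gt0 ?invr_gt0 ?exprn_gt0.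
Unshelve. all: by end_near.
Qed.

End Trajectory.

(** * Almost sure convergence of the proportions *)

Theorem theorem1p1 (R : realType) (m : nat) (E : {set {set 'I_m}}) :
  (0 < m)%N ->
  simple_graph E ->
  connected_graph E ->
  balanced_bipartite E ->
  exists J : set 'rV[R]_m,
    closed_interval J /\
    forall (B0 : 'I_m -> nat) (d : measure_display) (Omega : measurableType d)
           (P : probability Omega R)
           (c : nat -> {set 'I_m} -> Omega -> 'I_m),
      (forall i : 'I_m, (1 <= B0 i)%N) ->
      polya_urn E B0 P c ->
      {ae P, forall w : Omega, exists2 x : 'rV[R]_m,
        J x & proportions R E B0 c n w @[n --> \oo] --> x}.
Proof.
move=> m0 gE cE [A [B [AB cAB]]].
have [v bv] := load_maximizer_exists R m0 gE.
pose s : 'rV[R]_m := \row_i side R A i.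
exists [set (1 - t) *: (v - s) + t *: (v + s) | t in [set t : R | 0 <= t <= 1]].
split; first by exists (v - s), (v + s).
move=> B0 d Omega P c B0_gt0 urn.
have c_in n f w : f \in E -> c n.+1 f w \in f by case: urn => _ h _; exact: h.
apply: filterS (ln_balls_sub_rates_cvg gE B0_gt0 urn) => w compensated.
pose b n i : R := (balls E B0 c n w i)%:R.
have b_total n : \sum_i b n i = (\sum_j B0 j + n * #|E|)%N%:R.
  by rewrite /b -natr_sum balls_total.
have b_ge1 n i : 1 <= b n i by rewrite ler1n; exact: balls_gt0.
have b_step n : \sum_i b n.+1 i = \sum_i b n i + #|E|%:R.
  by rewrite !b_total -natrD mulSn addnCA addnC.
have b_edge n f : f \in E -> n%:R <= load (b n) f.
  by move=> fE; rewrite /load /b -natr_sum ler_nat; exact: balls_edge.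
have [x Jx xb] :=
  trajectory_cvg m0 gE cE AB cAB b_ge1 b_step b_edge compensated bv.
exists x => //.
have -> : (fun n => proportions R E B0 c n w)
    = (fun n => \row_i (b n i / \sum_j b n j)).
  by apply/funext => n; apply/rowP => i; rewrite !mxE b_total.
exact: xb.
Qed.
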